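(* Let $f\in C^2([0,1])$ satisfy $f(0)=f(1)=0$ and $0<f(s)\le f'(0)s$ for all $s\in(0,1)$, extended linearly to $\mathbb{R}\setminus[0,1]$. Let $\lambda_*=\sqrt{f'(0)}$, fix $\lambda\in(0,\lambda_* )$ and set $c=\lambda+f'(0)/\lambda$. Let $u_0:\mathbb{R}\to[0,1]$ be continuous and not identically zero, and suppose there exist $\nu\in\mathbb{R}$ and constants $0<a_1\le a_2$ such that $a_1x^{\nu}e^{-\lambda x}\le u_0(x)\le a_2x^{\nu}e^{-\lambda x}$ for all sufficiently large $x$. Let $u$ be the solution of $u_t=u_{xx}+f(u)$, $t>0$, $x\in\mathbb{R}$, with $u(0,\cdot)=u_0$, and for $m\in(0,1)$ let $X_m(t)=\sup\{x\in\mathbb{R}: u(t,x)\ge m\}$. Then for every $m\in(0,1)$, $X_m(t)-ct-\frac{\nu}{\lambda}\ln t$ is bounded as $t\to+\infty$.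
   Context: ''Extended linearly'' means $f$ is extended to $\mathbb{R}$ by affine functions outside $[0,1]$. Bounded as $t\to+\infty$ means bounded for all sufficiently large $t$. *)

(* Defs.v *)
From Stdlib Require Import Reals.
From Coquelicot Require Import Coquelicot.
Open Scope R_scope.

Definition C2_on_R (g : R -> R) : Prop :=
  forall x, ex_derive g x /\ ex_derive (Derive g) x /\
            continuous (Derive (Derive g)) x.

Definition cont_closed_halfplane (v : R -> R -> R) : Prop :=
  forall t0 x0, 0 <= t0 -> forall eps, 0 < eps ->
    exists delta, 0 < delta /\
      forall t x, 0 <= t -> Rabs (t - t0) < delta -> Rabs (x - x0) < delta ->
        Rabs (v t x - v t0 x0) < eps.

Definition cont_open_halfplane (v : R -> R -> R) : Prop :=
  forall t0 x0, 0 < t0 -> forall eps, 0 < eps ->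
    exists delta, 0 < delta /\
      forall t x, Rabs (t - t0) < delta -> Rabs (x - x0) < delta ->
        Rabs (v t x - v t0 x0) < eps.

Definition d_t (u : R -> R -> R) (t x : R) : R := Derive (fun s => u s x) t.
Definition d_x (u : R -> R -> R) (t x : R) : R := Derive (fun y => u t y) x.
Definition d_xx (u : R -> R -> R) (t x : R) : R :=
  Derive (fun y => d_x u t y) x.

Definition classical_solution (f u0 : R -> R) (u : R -> R -> R) : Prop :=
  (forall x, u 0 x = u0 x) /\
  cont_closed_halfplane u /\
  (exists M, forall t x, 0 <= t -> Rabs (u t x) <= M) /\
  (forall t x, 0 < t ->
     ex_derive (fun s => u s x) t /\
     ex_derive (fun y => u t y) x /\
     ex_derive (fun y => d_x u t y) x /\
     d_t u t x = d_xx u t x + f (u t x)) /\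
  cont_open_halfplane (d_t u) /\
  cont_open_halfplane (d_x u) /\
  cont_open_halfplane (d_xx u).

(* Main.v *)
Require Import Defs.
From Stdlib Require Import Reals Lra Classical ClassicalEpsilon.
From Coquelicot Require Import Coquelicot.
Open Scope R_scope.

(** Write [r = f'(0)], [y = x - 2 lam t], [c = lam + r / lam] and
[w = exp (beta - lam (x - c t)) (M^2 + y^2)^(nu/2) exp (A / (t + tau))].
Then [w_t - w_xx = (r + e) w], and where [y >= kap (t + tau)] the defect [e] is
[- A / (t + tau)^2 + O(1 / (t + tau)^2)], so the sign of [A] decides the sign of [e].
With [e >= 0] the function [w] is a supersolution there, and further left it exceeds [1].
With [e <= 0], [1 < sigma < r / lam^2] and [sigma <= 2], the function
[w - D w^sigma] is a subsolution, because [f s >= r s - K s^2]; further left it is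
negative. The level sets of [w] are at [c t + (nu / lam) ln t + O(1)], which gives
the upper bound, and shows that [u] is at least some [delta > 0] on an interval
of any prescribed length at that position. A subsolution positive only on such an interval
and growing exponentially in time then lifts [u] from [delta] to [m] within a time
independent of [t]. *)

Lemma exp_le_compat (x y : R) : x <= y -> exp x <= exp y.
Proof. intros [H| ->]; [left; now apply exp_increasing|lra]. Qed.

(** * Parabolic maximum principle *)

Lemma cont_closed_halfplane_max (F : R -> R -> R) (T r B : R) :
  0 <= T -> 0 <= r -> cont_closed_halfplane F ->
  (forall t x, 0 <= t <= T -> - r <= x <= r -> F t x <= B) ->
  exists t0 x0, 0 <= t0 <= T /\ - r <= x0 <= r /\
    forall t x, 0 <= t <= T -> - r <= x <= r -> F t x <= F t0 x0.
Proof.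
intros HT Hr HF HB.
set (P := fun z => exists t x, 0 <= t <= T /\ - r <= x <= r /\ z = F t x).
destruct (completeness P) as [S [HS1 HS2]].
{ exists B. intros z [t [x [Ht [Hx ->]]]]. now apply HB. }
{ exists (F 0 0), 0, 0. repeat split; lra. }
assert (HS : forall t x, 0 <= t <= T -> - r <= x <= r -> F t x <= S).
{ intros t x Ht Hx. apply HS1. now exists t, x. }
apply NNPP. intros Hno.
assert (Hlt : forall t x, 0 <= t <= T -> - r <= x <= r -> F t x < S).
{ intros t x Ht Hx. destruct (HS t x Ht Hx) as [H|H]; [exact H|].
  exfalso. apply Hno. exists t, x. repeat split; try lra.
  intros t' x' Ht' Hx'. rewrite H. now apply HS. }
assert (Hd : forall t x, exists d : posreal, 0 <= t <= T -> - r <= x <= r ->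
  d <= (S - F t x) / 2 /\
  forall t' x', 0 <= t' -> Rabs (t' - t) < d -> Rabs (x' - x) < d ->
    Rabs (F t' x' - F t x) < (S - F t x) / 2).
{ intros t x. destruct (classic (0 <= t <= T /\ - r <= x <= r)) as [[Ht Hx]|H].
  - assert (Hp := Hlt t x Ht Hx).
    destruct (HF t x (proj1 Ht) ((S - F t x) / 2)) as [d [Hd Hc]]; [lra|].
    assert (Hm : 0 < Rmin d ((S - F t x) / 2)) by (apply Rmin_pos; lra).
    exists (mkposreal _ Hm). intros _ _. simpl. split; [apply Rmin_r|].
    intros t' x' H0 H1 H2. assert (Hml := Rmin_l d ((S - F t x) / 2)).
    apply Hc; lra.
  - exists (mkposreal 1 Rlt_0_1). intros H1 H2. exfalso. now apply H. }
set (delta := fun t x => proj1_sig (constructive_indefinite_description _ (Hd t x))).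
destruct (compactness_value_2d 0 T (- r) r delta) as [d Hcomp].
assert (Hub : is_upper_bound P (S - d)).
{ intros z [t [x [Ht [Hx ->]]]]. apply Rnot_lt_le. intros Hc.
  apply (Hcomp t x Ht Hx). intros [t' [x' [Ht' [Hx' [H1 [H2 H3]]]]]].
  revert H1 H2 H3. unfold delta.
  destruct (constructive_indefinite_description _ (Hd t' x')) as [e He]. simpl.
  intros H1 H2 H3. destruct (He Ht' Hx') as [He1 He2].
  specialize (He2 t x (proj1 Ht) H1 H2). apply Rabs_def2 in He2. lra. }
assert (H := HS2 _ Hub). destruct d as [d Hdp]. simpl in H. lra.
Qed.

Lemma is_derive_diff_quot (phi : R -> R) (t a eps : R) :
  is_derive phi t a -> 0 < eps ->
  exists d, 0 < d /\ forall s, Rabs (s - t) < d ->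
    Rabs (phi s - phi t - a * (s - t)) <= eps * Rabs (s - t).
Proof.
intros [_ H] He.
destruct (H t (fun P HP => HP) (mkposreal eps He)) as [d Hd].
exists d. split; [apply cond_pos|]. intros s Hs.
specialize (Hd s Hs). unfold norm, minus, plus, opp, scal in Hd. simpl in Hd.
unfold abs, mult in Hd. simpl in Hd.
replace (phi s - phi t - a * (s - t))
  with (phi s + - phi t + - ((s + - t) * a)) by ring.
exact Hd.
Qed.

Lemma is_derive_left_max (phi : R -> R) (t a d : R) :
  is_derive phi t a -> 0 < d -> (forall s, t - d < s < t -> phi s <= phi t) ->
  0 <= a.
Proof.
intros H Hd Hm. apply Rnot_lt_le. intros Ha.
destruct (is_derive_diff_quot phi t a (- a / 2) H) as [e [He Hq]]; [lra|].
set (h := Rmin d e / 2).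
assert (0 < Rmin d e) by (apply Rmin_pos; lra).
assert (Rmin d e <= d) by apply Rmin_l.
assert (Rmin d e <= e) by apply Rmin_r.
assert (Hs : Rabs (t - h - t) = h).
{ replace (t - h - t) with (- h) by ring. rewrite Rabs_Ropp.
  apply Rabs_pos_eq. unfold h. lra. }
specialize (Hm (t - h)). specialize (Hq (t - h)). rewrite Hs in Hq.
assert (H3 : h < e) by (unfold h; lra).
assert (H4 : t - d < t - h < t) by (unfold h; lra).
specialize (Hm H4). specialize (Hq H3). apply Rabs_le_between in Hq.
assert (0 < h) by (unfold h; lra). nra.
Qed.

Lemma is_derive_local_max (phi : R -> R) (x a d : R) :
  is_derive phi x a -> 0 < d -> (forall y, Rabs (y - x) < d -> phi y <= phi x) ->
  a = 0.
Proof.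
intros H Hd Hm. apply Rle_antisym.
- cut (0 <= - a); [lra|].
  apply (is_derive_left_max (fun s => phi (- s)) (- x) (- a) d); [|exact Hd|].
  + replace (- a) with (scal (-1) a) by (unfold scal; simpl; unfold mult; simpl; ring).
    apply (is_derive_comp phi (fun s => - s)).
    * now rewrite Ropp_involutive.
    * auto_derive; [easy|ring].
  + intros s Hs. rewrite Ropp_involutive. apply Hm. apply Rabs_def1; lra.
- apply (is_derive_left_max phi x a d H Hd).
  intros s Hs. apply Hm. apply Rabs_def1; lra.
Qed.

Lemma second_derivative_local_max (phi p : R -> R) (x b d : R) :
  (forall y, is_derive phi y (p y)) -> is_derive p x b -> 0 < d ->
  (forall y, Rabs (y - x) < d -> phi y <= phi x) -> b <= 0.
Proof.
intros Hphi Hp Hd Hm.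
assert (H0 := is_derive_local_max phi x (p x) d (Hphi x) Hd Hm).
apply Rnot_lt_le. intros Hb.
destruct (is_derive_diff_quot p x b (b / 2) Hp) as [e [He Hq]]; [lra|].
assert (0 < Rmin d e) by (apply Rmin_pos; lra).
assert (Rmin d e <= d) by apply Rmin_l.
assert (Rmin d e <= e) by apply Rmin_r.
set (h := Rmin d e / 2).
assert (Hh : 0 < h < Rmin d e) by (unfold h; lra).
destruct (MVT_cor2 phi p x (x + h)) as [z [Hz1 Hz2]]; [lra| |].
{ intros z _. apply is_derive_Reals, Hphi. }
assert (Hx : phi (x + h) <= phi x).
{ apply Hm. replace (x + h - x) with h by ring. rewrite Rabs_pos_eq; lra. }
specialize (Hq z). rewrite (Rabs_pos_eq (z - x)) in Hq by lra.
assert (H3 : z - x < e) by lra. specialize (Hq H3).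
apply Rabs_le_between in Hq. rewrite H0 in Hq.
assert (0 < p z) by nra. nra.
Qed.

Lemma cont_closed_halfplane_comp (G : R * (R * R) -> R) (v : R -> R -> R) :
  cont_closed_halfplane v ->
  (forall t x z, 0 <= t -> continuous G (t, (x, z))) ->
  cont_closed_halfplane (fun t x => G (t, (x, v t x))).
Proof.
intros Hv HG t0 x0 Ht0 e He.
destruct (proj1 (filterlim_locally G _) (HG t0 x0 (v t0 x0) Ht0) (mkposreal e He))
  as [d Hd].
destruct (Hv t0 x0 Ht0 d (cond_pos d)) as [d' [Hd' Hc]].
exists (Rmin d d'). split; [apply Rmin_pos; [apply cond_pos|exact Hd']|].
intros t x Ht H1 H2.
assert (Rmin d d' <= d) by apply Rmin_l.
assert (Rmin d d' <= d') by apply Rmin_r.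
apply (Hd (t, (x, v t x))). split; [|split]; simpl.
- change (Rabs (t - t0) < d). lra.
- change (Rabs (x - x0) < d). lra.
- change (Rabs (v t x - v t0 x0) < d). apply Hc; lra.
Qed.

Definition has_heat_derivs (v : R -> R -> R) (t x a b : R) : Prop :=
  is_derive (fun s => v s x) t a /\
  exists p : R -> R, (forall y, is_derive (v t) y (p y)) /\ is_derive p x b.

Lemma parabolic_max_principle (Z : R -> R -> R) (K T B : R) :
  cont_closed_halfplane Z ->
  (forall t x, 0 <= t <= T -> Z t x <= B) ->
  (forall x, Z 0 x <= 0) ->
  (forall t x, 0 < t <= T -> 0 < Z t x ->
     exists a b, has_heat_derivs Z t x a b /\ a <= b + K * Z t x) ->
  forall t x, 0 <= t <= T -> Z t x <= 0.
Proof.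
intros Hc HB H0 Heq t1 x1 Ht1. apply Rnot_lt_le. intros Hpos.
set (z1 := exp (- K * t1) * Z t1 x1).
assert (Hz1 : 0 < z1) by (apply Rmult_lt_0_compat; [apply exp_pos|exact Hpos]).
set (q1 := x1 ^ 2 + 3 * t1 + 1).
assert (Hq1 : 0 < q1) by (unfold q1; nra).
set (eps := z1 / (2 * q1)).
assert (Heps : 0 < eps) by (unfold eps; apply Rdiv_lt_0_compat; lra).
set (F := fun t x => exp (- K * t) * Z t x - eps * (x ^ 2 + 3 * t)).
set (B' := Rabs B * exp (Rabs K * T)).
assert (HB' : forall t x, 0 <= t <= T -> exp (- K * t) * Z t x <= B').
{ intros t x Ht. unfold B'.
  apply Rle_trans with (exp (- K * t) * Rabs B).
  - apply Rmult_le_compat_l; [left; apply exp_pos|].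
    apply Rle_trans with B; [now apply HB|apply Rle_abs].
  - rewrite Rmult_comm. apply Rmult_le_compat_l; [apply Rabs_pos|].
    apply exp_le_compat.
    assert (- K <= Rabs K) by (rewrite <- Rabs_Ropp; apply Rle_abs).
    assert (0 <= Rabs K) by apply Rabs_pos. nra. }
assert (HB'0 : 0 <= B').
{ apply Rmult_le_pos; [apply Rabs_pos|left; apply exp_pos]. }
set (r := Rabs x1 + B' / eps + 1).
assert (Hbe : 0 <= B' / eps) by (apply Rdiv_le_0_compat; lra).
assert (Hr : B' < eps * r ^ 2).
{ assert (0 <= Rabs x1) by apply Rabs_pos.
  assert (Hre : B' / eps * eps = B') by (field; lra).
  assert (B' / eps + 1 <= r) by (unfold r; lra).
  assert (r <= r ^ 2) by nra. nra. }
assert (Hr0 : 0 < r) by (unfold r; assert (0 <= Rabs x1) by apply Rabs_pos; lra).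
assert (HFc : cont_closed_halfplane F).
{ apply (cont_closed_halfplane_comp (fun q : R * (R * R) =>
     exp (- K * fst q) * snd (snd q) - eps * ((fst (snd q)) ^ 2 + 3 * fst q)) Z Hc).
  intros t x z _.
  apply (continuous_minus (V := R_NormedModule)).
  - apply (continuous_mult (K := R_AbsRing)).
    + apply (continuous_comp (fun q : R * (R * R) => - K * fst q) exp).
      * apply (continuous_mult (K := R_AbsRing));
          [apply continuous_const|apply continuous_fst].
      * apply (ex_derive_continuous (V := R_NormedModule)). auto_derive; easy.
    + apply (continuous_comp snd snd); [apply continuous_snd|apply continuous_snd].
  - apply (continuous_mult (K := R_AbsRing)); [apply continuous_const|].
    apply (continuous_plus (V := R_NormedModule)).
    + apply (continuous_comp (fun q : R * (R * R) => fst (snd q)) (fun y => y ^ 2)).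
      * apply (continuous_comp snd fst); [apply continuous_snd|apply continuous_fst].
      * apply (ex_derive_continuous (V := R_NormedModule)). auto_derive; easy.
    + apply (continuous_mult (K := R_AbsRing));
        [apply continuous_const|apply continuous_fst]. }
destruct (cont_closed_halfplane_max F T r B') as [t0 [x0 [Ht0 [Hx0 Hmax]]]];
  [lra|lra|exact HFc| |].
{ intros t x Ht Hx. unfold F. specialize (HB' t x Ht).
  assert (0 <= eps * (x ^ 2 + 3 * t)) by (apply Rmult_le_pos; nra). lra. }
assert (HF1 : 0 < F t1 x1).
{ unfold F. fold z1. assert (eps * (2 * q1) = z1) by (unfold eps; field; lra).
  unfold q1 in *. nra. }
assert (Hx1 : - r <= x1 <= r).
{ apply Rabs_le_between. unfold r. lra. }
assert (HF0 : 0 < F t0 x0) by (specialize (Hmax t1 x1 Ht1 Hx1); lra).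
assert (He0 := exp_pos (- K * t0)).
assert (HeZ : 0 < exp (- K * t0) * Z t0 x0).
{ unfold F in HF0. assert (0 <= eps * (x0 ^ 2 + 3 * t0)) by (apply Rmult_le_pos; nra).
  lra. }
assert (HZ0 : 0 < Z t0 x0) by nra.
assert (Ht0p : 0 < t0).
{ destruct (proj1 Ht0) as [H|H]; [exact H|]. exfalso. rewrite <- H in HZ0.
  specialize (H0 x0). lra. }
assert (Hx0r : x0 ^ 2 < r ^ 2).
{ apply Rnot_le_lt. intros H. unfold F in HF0. specialize (HB' t0 x0 Ht0). nra. }
assert (Hx0i : - r < x0 < r) by nra.
destruct (Heq t0 x0) as [a [b [[Ha [p [Hp Hb]]] Hab]]]; [lra|exact HZ0|].
assert (HFt : 0 <= exp (- K * t0) * (a - K * Z t0 x0) - 3 * eps).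
{ apply (is_derive_left_max (fun s => F s x0) t0 _ t0); [|exact Ht0p|].
  - unfold F. auto_derive.
    + now exists a.
    + rewrite (is_derive_unique (fun s : R => Z s x0) t0 a Ha). ring.
  - intros s Hs. apply Hmax; lra. }
assert (HFx : exp (- K * t0) * b - 2 * eps <= 0).
{ set (d := Rmin (r - x0) (r + x0)).
  apply (second_derivative_local_max (F t0)
           (fun y => exp (- K * t0) * p y - eps * (2 * y)) x0 _ d).
  - intros y. unfold F. auto_derive.
    + now exists (p y).
    + rewrite (is_derive_unique (fun y : R => Z t0 y) y (p y) (Hp y)). ring.
  - auto_derive.
    + now exists b.
    + rewrite (is_derive_unique (fun y : R => p y) x0 b Hb). ring.
  - apply Rmin_pos; lra.
  - intros y Hy. apply Hmax; [exact Ht0|].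
    assert (d <= r - x0) by apply Rmin_l. assert (d <= r + x0) by apply Rmin_r.
    apply Rabs_def2 in Hy. lra. }
nra.
Qed.

Lemma has_heat_derivs_const (k t x : R) : has_heat_derivs (fun _ _ => k) t x 0 0.
Proof.
split; [apply (is_derive_const k)|].
exists (fun _ => 0). split; [intros y; apply (is_derive_const k)|].
apply (is_derive_const (0 : R)).
Qed.

Lemma has_heat_derivs_minus (v w : R -> R -> R) (t x a b a' b' : R) :
  has_heat_derivs v t x a b -> has_heat_derivs w t x a' b' ->
  has_heat_derivs (fun s y => v s y - w s y) t x (a - a') (b - b').
Proof.
intros [H1 [p [H2 H3]]] [H1' [p' [H2' H3']]]. split.
- now apply (is_derive_minus (fun s => v s x) (fun s => w s x)).
- exists (fun y => p y - p' y). split.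
  + intros y. apply (is_derive_minus (v t) (w t)); [apply H2|apply H2'].
  + now apply (is_derive_minus p p').
Qed.

Lemma cont_closed_halfplane_minus (v w : R -> R -> R) :
  cont_closed_halfplane v -> cont_closed_halfplane w ->
  cont_closed_halfplane (fun t x => v t x - w t x).
Proof.
intros Hv Hw t0 x0 Ht0 e He.
destruct (Hv t0 x0 Ht0 (e / 2)) as [d [Hd Hc]]; [lra|].
destruct (Hw t0 x0 Ht0 (e / 2)) as [d' [Hd' Hc']]; [lra|].
exists (Rmin d d'). split; [now apply Rmin_pos|].
intros t x Ht H1 H2.
assert (Rmin d d' <= d) by apply Rmin_l.
assert (Rmin d d' <= d') by apply Rmin_r.
assert (H3 : Rabs (v t x - v t0 x0) < e / 2) by (apply Hc; lra).
assert (H4 : Rabs (w t x - w t0 x0) < e / 2) by (apply Hc'; lra).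
apply Rabs_def2 in H3. apply Rabs_def2 in H4. apply Rabs_def1; lra.
Qed.

Lemma cont_closed_halfplane_continuous (v : R -> R -> R) :
  (forall t x, 0 <= t -> continuous (fun q : R * R => v (fst q) (snd q)) (t, x)) ->
  cont_closed_halfplane v.
Proof.
intros H.
apply (cont_closed_halfplane_comp (fun q => v (fst q) (fst (snd q))) (fun _ _ => 0)).
- intros t0 x0 _ e He. exists 1. split; [lra|]. intros.
  rewrite Rminus_diag, Rabs_R0. exact He.
- intros t x z Ht.
  apply (continuous_comp_2 fst (fun q : R * (R * R) => fst (snd q)) v).
  + apply continuous_fst.
  + apply (continuous_comp snd fst); [apply continuous_snd|apply continuous_fst].
  + now apply H.
Qed.

Lemma parabolic_comparison (v w : R -> R -> R) (K T B : R) :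
  cont_closed_halfplane v -> cont_closed_halfplane w ->
  (forall t x, 0 <= t <= T -> v t x - w t x <= B) ->
  (forall x, v 0 x <= w 0 x) ->
  (forall t x, 0 < t <= T -> w t x < v t x ->
     exists a b a' b', has_heat_derivs v t x a b /\ has_heat_derivs w t x a' b' /\
       (a - b) - (a' - b') <= K * (v t x - w t x)) ->
  forall t x, 0 <= t <= T -> v t x <= w t x.
Proof.
intros Hv Hw HB H0 H t x Ht.
cut (v t x - w t x <= 0); [lra|].
apply (parabolic_max_principle (fun t x => v t x - w t x) K T B);
  [now apply cont_closed_halfplane_minus|exact HB| | |exact Ht].
- intros y. specialize (H0 y). lra.
- intros s y Hs Hp. destruct (H s y Hs) as [a [b [a' [b' [H1 [H2 H3]]]]]]; [lra|].
  exists (a - a'), (b - b'). split; [now apply has_heat_derivs_minus|lra].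
Qed.

(** * Consequences for classical solutions *)

Lemma solution_heat_derivs (f u0 : R -> R) (u : R -> R -> R) (s t x : R) :
  classical_solution f u0 u -> 0 < s + t ->
  exists a b, has_heat_derivs (fun t' => u (s + t')) t x a b /\
    a - b = f (u (s + t) x).
Proof.
intros [_ [_ [_ [H _]]]] Ht.
destruct (H (s + t) x Ht) as [H1 [_ [H3 H4]]].
exists (d_t u (s + t) x), (d_xx u (s + t) x). split; [|lra]. split.
- replace (d_t u (s + t) x) with (1 * d_t u (s + t) x) by ring.
  apply (is_derive_comp (fun t' => u t' x) (fun t' => s + t')).
  + now apply Derive_correct.
  + auto_derive; [easy|ring].
- exists (d_x u (s + t)). split.
  + intros y. apply Derive_correct. now destruct (H (s + t) y Ht) as [_ [H2 _]].
  + now apply Derive_correct.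
Qed.

Lemma solution_cont_shift (f u0 : R -> R) (u : R -> R -> R) (s : R) :
  classical_solution f u0 u -> 0 <= s ->
  cont_closed_halfplane (fun t => u (s + t)).
Proof.
intros [_ [H _]] Hs t0 x0 Ht0 e He.
destruct (H (s + t0) x0) with (eps := e) as [d [Hd Hc]]; [lra|exact He|].
exists d. split; [exact Hd|]. intros t x Ht H1 H2.
apply Hc; [lra| |exact H2]. now replace (s + t - (s + t0)) with (t - t0) by ring.
Qed.

Lemma solution_le_1 (f u0 : R -> R) (u : R -> R -> R) (k : R) :
  classical_solution f u0 u -> (forall s, 1 < s -> f s = k * (s - 1)) ->
  (forall x, u0 x <= 1) -> forall t x, 0 <= t -> u t x <= 1.
Proof.
intros Hu Hf H0 t x Ht. rewrite <- (Rplus_0_l t).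
assert (Hb := Hu). destruct Hb as [Hu0 [_ [[M HM] _]]].
apply (parabolic_comparison (fun t => u (0 + t)) (fun _ _ => 1) k t M);
  [eapply solution_cont_shift; [exact Hu|lra]| | | | |lra].
- apply cont_closed_halfplane_continuous. intros. apply continuous_const.
- intros s y Hs. rewrite Rplus_0_l.
  assert (H := HM s y (proj1 Hs)). apply Rabs_le_between in H. lra.
- intros y. rewrite Rplus_0_l, Hu0. apply H0.
- intros s y Hs Hlt.
  destruct (solution_heat_derivs f u0 u 0 s y Hu) as [a [b [Hd Hab]]]; [lra|].
  exists a, b, 0, 0. split; [exact Hd|]. split; [apply has_heat_derivs_const|].
  rewrite Hab, Hf by exact Hlt. lra.
Qed.

Lemma solution_ge_0 (f u0 : R -> R) (u : R -> R -> R) (k : R) :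
  classical_solution f u0 u -> (forall s, s < 0 -> f s = k * s) ->
  (forall x, 0 <= u0 x) -> forall t x, 0 <= t -> 0 <= u t x.
Proof.
intros Hu Hf H0 t x Ht. rewrite <- (Rplus_0_l t).
assert (Hb := Hu). destruct Hb as [Hu0 [_ [[M HM] _]]].
apply (parabolic_comparison (fun _ _ => 0) (fun t => u (0 + t)) k t M);
  [|eapply solution_cont_shift; [exact Hu|lra]| | | |lra].
- apply cont_closed_halfplane_continuous. intros. apply continuous_const.
- intros s y Hs. rewrite Rplus_0_l.
  assert (H := HM s y (proj1 Hs)). apply Rabs_le_between in H. lra.
- intros y. rewrite Rplus_0_l, Hu0. apply H0.
- intros s y Hs Hlt.
  destruct (solution_heat_derivs f u0 u 0 s y Hu) as [a [b [Hd Hab]]]; [lra|].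
  exists 0, 0, a, b. split; [apply has_heat_derivs_const|]. split; [exact Hd|].
  rewrite Hab, Hf by exact Hlt. lra.
Qed.

Lemma C2_ge_quadratic (g : R -> R) :
  C2_on_R g -> g 0 = 0 ->
  exists K, 0 < K /\ forall s, 0 <= s <= 1 -> Derive g 0 * s - K * s ^ 2 <= g s.
Proof.
intros Hg H0.
destruct (continuity_ab_maj (fun x => Rabs (Derive (Derive g) x)) 0 1) as [z [Hz _]];
  [lra| |].
{ intros c _. apply continuity_pt_filterlim.
  apply (continuous_comp (Derive (Derive g)) Rabs); [apply Hg|].
  apply (continuous_abs (K := R_AbsRing)). }
set (K := Rabs (Derive (Derive g) z) + 1) in *.
assert (HK : 0 < K) by (unfold K; assert (H := Rabs_pos (Derive (Derive g) z)); lra).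
assert (Hd1 : forall y, derivable_pt_lim g y (Derive g y)).
{ intros y. apply is_derive_Reals, Derive_correct, Hg. }
assert (Hd2 : forall y, derivable_pt_lim (Derive g) y (Derive (Derive g) y)).
{ intros y. apply is_derive_Reals, Derive_correct, Hg. }
exists K. split; [exact HK|]. intros s Hs.
destruct (proj1 Hs) as [Hs0|<-]; [|rewrite H0; lra].
destruct (MVT_cor2 g (Derive g) 0 s Hs0) as [y [Hy1 Hy2]]; [intros; apply Hd1|].
destruct (MVT_cor2 (Derive g) (Derive (Derive g)) 0 y (proj1 Hy2)) as [q [Hq1 Hq2]];
  [intros; apply Hd2|].
assert (Hq : - K <= Derive (Derive g) q).
{ assert (H := Hz q). simpl in H. assert (Hq01 : 0 <= q <= 1) by lra.
  specialize (H Hq01). assert (H' := Rabs_maj2 (Derive (Derive g) q)).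
  unfold K. lra. }
rewrite H0 in Hy1. assert (- K * y <= Derive g y - Derive g 0) by nra.
assert (- K * s <= Derive g y - Derive g 0) by nra. nra.
Qed.

Lemma kpp_ge_linear (f g : R -> R) (r K m : R) :
  (forall x, continuous g x) -> (forall s, 0 <= s <= 1 -> f s = g s) ->
  (forall s, 0 < s < 1 -> 0 < f s) -> 0 < r -> 0 < K -> 0 < m < 1 ->
  (forall s, 0 <= s <= 1 -> r * s - K * s ^ 2 <= f s) ->
  exists theta, 0 < theta /\ forall s, 0 <= s <= m -> theta * s <= f s.
Proof.
intros Hg Hfg Hp Hr HK Hm Hq.
set (s0 := Rmin (r / (2 * K)) m).
assert (Hrk : 0 < r / (2 * K)) by (apply Rdiv_lt_0_compat; lra).
assert (Hs0 : 0 < s0) by (apply Rmin_pos; lra).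
assert (Hs1 : s0 <= r / (2 * K)) by apply Rmin_l.
assert (Hs2 : s0 <= m) by apply Rmin_r.
destruct (continuity_ab_min g s0 m Hs2) as [z [Hz1 Hz2]].
{ intros c _. apply continuity_pt_filterlim. apply Hg. }
assert (Hz : 0 < g z) by (rewrite <- Hfg by lra; apply Hp; lra).
exists (Rmin (r / 2) (g z)). split; [apply Rmin_pos; lra|].
intros s Hs.
assert (Rmin (r / 2) (g z) <= r / 2) by apply Rmin_l.
assert (Rmin (r / 2) (g z) <= g z) by apply Rmin_r.
destruct (Rle_lt_dec s s0) as [Hc|Hc].
- assert (H1 := Hq s). assert (H2 : K * s <= r / 2).
  { apply Rle_trans with (K * (r / (2 * K))); [apply Rmult_le_compat_l; lra|].
    right. field. lra. }
  assert (0 <= s <= 1) by lra. specialize (H1 H3). nra.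
- assert (H1 := Hz1 s). assert (H2 : s0 <= s <= m) by lra. specialize (H1 H2).
  rewrite Hfg by lra. nra.
Qed.

(* [psi = 2 L^2 / (L^2 + z^2) - 1] satisfies [- psi'' <= (8 / L^2) psi] where it is
   positive and, being smooth on the whole line, needs no truncation at [|z| = L]. *)
Lemma bump_growth (f u0 : R -> R) (u : R -> R -> R) (theta m : R) :
  classical_solution f u0 u -> (forall t x, 0 <= t -> 0 <= u t x) ->
  0 < theta -> 0 < m -> (forall s, 0 <= s <= m -> theta * s <= f s) ->
  exists L, 0 < L /\ forall delta, 0 < delta ->
    exists s0, 0 <= s0 /\ forall t1 x1, 0 < t1 ->
      (forall x, Rabs (x - x1) <= L -> delta <= u t1 x) -> m <= u (t1 + s0) x1.
Proof.
intros Hu Hu0 Hth Hm Hf.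
assert (Hsq : 0 < sqrt theta) by now apply sqrt_lt_R0.
set (L := 4 / sqrt theta).
assert (HL : 0 < L) by (apply Rdiv_lt_0_compat; lra).
assert (HthL : theta * L ^ 2 = 16).
{ unfold L. rewrite <- (sqrt_sqrt theta) at 1 by lra. field. lra. }
exists L. split; [exact HL|]. intros delta Hd.
destruct (Rle_lt_dec m delta) as [Hmd|Hdm].
{ exists 0. split; [lra|]. intros t1 x1 Ht1 H. rewrite Rplus_0_r.
  apply Rle_trans with delta; [exact Hmd|apply H].
  rewrite Rminus_diag, Rabs_R0. lra. }
set (s0 := 2 / theta * ln (m / delta)).
assert (Hln : 0 < ln (m / delta)).
{ rewrite <- ln_1. apply ln_increasing; [lra|]. apply Rlt_div_r; lra. }
assert (Hs0 : 0 < s0).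
{ apply Rmult_lt_0_compat; [apply Rdiv_lt_0_compat; lra|exact Hln]. }
assert (Hend : delta * exp (theta / 2 * s0) = m).
{ unfold s0. replace (theta / 2 * (2 / theta * ln (m / delta))) with (ln (m / delta))
    by (field; lra).
  rewrite exp_ln by (apply Rdiv_lt_0_compat; lra). field. lra. }
exists s0. split; [lra|]. intros t1 x1 Ht1 Hinit.
set (v := fun t x => delta * exp (theta / 2 * t) *
                     (2 * L ^ 2 / (L ^ 2 + (x - x1) ^ 2) - 1)).
assert (HL2 : 0 < L ^ 2) by nra.
assert (Hden : forall x, 0 < L ^ 2 + (x - x1) ^ 2).
{ intros x. assert (0 <= (x - x1) ^ 2) by apply pow2_ge_0. lra. }
assert (Hpsi : forall x, 2 * L ^ 2 / (L ^ 2 + (x - x1) ^ 2) - 1 <= 1).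
{ intros x. specialize (Hden x). assert (H := pow2_ge_0 (x - x1)).
  cut (2 * L ^ 2 / (L ^ 2 + (x - x1) ^ 2) <= 2); [lra|].
  apply Rle_div_l; [exact Hden|lra]. }
assert (Hamp : forall t, t <= s0 -> 0 < delta * exp (theta / 2 * t) <= m).
{ intros t Ht. assert (He := exp_pos (theta / 2 * t)).
  split; [now apply Rmult_lt_0_compat|].
  rewrite <- Hend. apply Rmult_le_compat_l; [lra|].
  apply exp_le_compat. apply Rmult_le_compat_l; lra. }
assert (Hvm : forall t x, t <= s0 -> v t x <= m).
{ intros t x Ht. unfold v. specialize (Hamp t Ht). specialize (Hpsi x).
  set (A := delta * exp (theta / 2 * t)) in *. nra. }
cut (v s0 x1 <= u (t1 + s0) x1).
{ unfold v. rewrite Hend. intros H.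
  replace (m * (2 * L ^ 2 / (L ^ 2 + (x1 - x1) ^ 2) - 1)) with m in H; [exact H|].
  field. rewrite Rminus_diag. lra. }
apply (parabolic_comparison v (fun t => u (t1 + t)) theta s0 m);
  [|eapply solution_cont_shift; [exact Hu|lra]| | | |lra].
- apply cont_closed_halfplane_continuous. intros t x _. unfold v.
  apply (continuous_mult (K := R_AbsRing)).
  + apply (continuous_comp fst (fun t => delta * exp (theta / 2 * t)));
      [apply continuous_fst|].
    apply (ex_derive_continuous (V := R_NormedModule)). auto_derive. easy.
  + apply (continuous_comp snd (fun x => 2 * L ^ 2 / (L ^ 2 + (x - x1) ^ 2) - 1));
      [apply continuous_snd|].
    apply (ex_derive_continuous (V := R_NormedModule)). auto_derive.
    specialize (Hden x). simpl in *. lra.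
- intros t x Ht. assert (H := Hvm t x (proj2 Ht)).
  assert (H' : 0 <= u (t1 + t) x) by (apply Hu0; lra). lra.
- intros x. rewrite Rplus_0_r. unfold v. rewrite Rmult_0_r, exp_0, Rmult_1_r.
  destruct (Rle_lt_dec (Rabs (x - x1)) L) as [Hx|Hx].
  + specialize (Hinit x Hx). specialize (Hpsi x). nra.
  + assert (H0 : 0 <= u t1 x) by (apply Hu0; lra).
    assert (Hsqx : L ^ 2 < (x - x1) ^ 2).
    { rewrite <- (pow2_abs (x - x1)). nra. }
    assert (2 * L ^ 2 / (L ^ 2 + (x - x1) ^ 2) <= 1).
    { apply Rle_div_l; [apply Hden|lra]. }
    nra.
- intros t x Ht Hlt.
  destruct (solution_heat_derivs f u0 u t1 t x Hu) as [a [b [Hdu Hab]]]; [lra|].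
  set (z := x - x1) in *.
  exists (theta / 2 * v t x),
    (delta * exp (theta / 2 * t) *
      (4 * L ^ 2 * (3 * (x - x1) ^ 2 - L ^ 2) / (L ^ 2 + (x - x1) ^ 2) ^ 3)), a, b.
  split; [|split; [exact Hdu|]].
  + split.
    * unfold v. auto_derive; [easy|]. field. specialize (Hden x). lra.
    * exists (fun y => delta * exp (theta / 2 * t) *
        (- 4 * L ^ 2 * (y - x1) / (L ^ 2 + (y - x1) ^ 2) ^ 2)). split.
      -- intros y. unfold v. specialize (Hden y). auto_derive; [simpl in *; lra|].
         field. lra.
      -- specialize (Hden x). auto_derive; [simpl in *; nra|]. field. lra.
  + assert (Hw0 : 0 <= u (t1 + t) x) by (apply Hu0; lra).
    assert (Hvt := Hvm t x (proj2 Ht)).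
    assert (Hfu := Hf (u (t1 + t) x)). rewrite Hab.
    assert (Hkey : - (delta * exp (theta / 2 * t) *
      (4 * L ^ 2 * (3 * (x - x1) ^ 2 - L ^ 2) / (L ^ 2 + (x - x1) ^ 2) ^ 3))
      <= theta / 2 * v t x).
    { assert (Ha := proj1 (Hamp t (proj2 Ht))). specialize (Hden x).
      assert (Hv0 : 0 < v t x) by lra. unfold v in Hv0 |- *.
      set (A := delta * exp (theta / 2 * t)) in *. fold z in Hden, Hv0 |- *.
      assert (Hq : 0 <= z ^ 2) by apply pow2_ge_0.
      set (q := z ^ 2) in *. set (P := L ^ 2) in *.
      assert (Hpq : q < P).
      { apply Rnot_le_lt. intros Hc.
        assert (2 * P / (P + q) <= 1) by (apply Rle_div_l; lra). nra. }
      replace (theta / 2) with (8 / P)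
        by (replace theta with (16 / P) by (field_simplify_eq; lra); field; lra).
      replace (8 / P * (A * (2 * P / (P + q) - 1)))
        with (A * (8 * (P - q) * (P + q) ^ 2 / (P * (P + q) ^ 3))) by (field; lra).
      replace (- (A * (4 * P * (3 * q - P) / (P + q) ^ 3)))
        with (A * (4 * P ^ 2 * (P - 3 * q) / (P * (P + q) ^ 3))) by (field; lra).
      apply Rmult_le_compat_l; [lra|].
      assert (Hdp : 0 < P * (P + q) ^ 3) by (apply Rmult_lt_0_compat; [lra|apply pow_lt; lra]).
      apply Rmult_le_compat_r; [left; now apply Rinv_0_lt_compat|].
      assert (P ^ 2 <= (P + q) ^ 2) by nra.
      assert (4 * P ^ 2 * (P - 3 * q) <= 8 * (P - q) * P ^ 2) by nra.
      nra. }
    assert (0 <= u (t1 + t) x <= m) by lra. specialize (Hfu H). lra.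
Qed.

(** * The logarithm of the barrier *)

Definition phase (lam nu c M A tau beta t x : R) : R :=
  beta - lam * (x - c * t) + nu / 2 * ln (M ^ 2 + (x - 2 * lam * t) ^ 2)
  + A / (t + tau).

Definition phase_x (lam nu M t x : R) : R :=
  - lam + nu * (x - 2 * lam * t) / (M ^ 2 + (x - 2 * lam * t) ^ 2).

Lemma sum_sq_pos (M y : R) : 0 < M -> 0 < M ^ 2 + y ^ 2.
Proof. intros H. assert (H1 := pow2_ge_0 y). nra. Qed.

Lemma phase_derive_t (lam nu c M A tau beta t x : R) :
  0 < M -> 0 < t + tau ->
  is_derive (fun s => phase lam nu c M A tau beta s x) t
    (lam * c - 2 * lam * (nu * (x - 2 * lam * t) / (M ^ 2 + (x - 2 * lam * t) ^ 2))
     - A / (t + tau) ^ 2).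
Proof.
intros HM Ht. assert (H := sum_sq_pos M (x - 2 * lam * t) HM).
unfold phase. auto_derive.
- simpl in *. repeat split; lra.
- field. simpl in *. split; lra.
Qed.

Lemma phase_derive_x (lam nu c M A tau beta t x : R) :
  0 < M -> is_derive (phase lam nu c M A tau beta t) x (phase_x lam nu M t x).
Proof.
intros HM. assert (H := sum_sq_pos M (x - 2 * lam * t) HM).
unfold phase, phase_x. auto_derive.
- simpl in *. lra.
- field. simpl in *. lra.
Qed.

Lemma phase_x_derive (lam nu M t x : R) :
  0 < M ->
  is_derive (phase_x lam nu M t) x
    (nu * (M ^ 2 - (x - 2 * lam * t) ^ 2) / (M ^ 2 + (x - 2 * lam * t) ^ 2) ^ 2).
Proof.
intros HM. assert (H := sum_sq_pos M (x - 2 * lam * t) HM).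
unfold phase_x. auto_derive.
- simpl in *. lra.
- field. simpl in *. lra.
Qed.

Lemma phase_slope (lam nu M t x h : R) :
  0 < M -> Rabs nu <= 2 * h * M -> Rabs (phase_x lam nu M t x + lam) <= h.
Proof.
intros HM Hh. unfold phase_x. set (y := x - 2 * lam * t).
assert (H := sum_sq_pos M y HM).
replace (- lam + nu * y / (M ^ 2 + y ^ 2) + lam) with (nu * y / (M ^ 2 + y ^ 2)) by ring.
unfold Rdiv. rewrite Rabs_mult, Rabs_mult.
rewrite (Rabs_pos_eq (/ _)) by (left; now apply Rinv_0_lt_compat).
apply Rle_div_l; [exact H|].
assert (0 <= Rabs y) by apply Rabs_pos. rewrite <- (pow2_abs y).
assert (0 <= (M - Rabs y) ^ 2) by apply pow2_ge_0.
assert (0 <= Rabs nu) by apply Rabs_pos.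
assert (0 <= h) by nra.
assert (Rabs nu * Rabs y <= 2 * h * M * Rabs y) by (apply Rmult_le_compat_r; lra).
nra.
Qed.

Lemma phase_decreasing (lam nu c M A tau beta t x y : R) :
  0 < M -> Rabs nu <= 2 * lam * M -> x <= y ->
  phase lam nu c M A tau beta t y <= phase lam nu c M A tau beta t x.
Proof.
intros HM Hnu [Hxy|<-]; [|lra].
destruct (MVT_cor2 (phase lam nu c M A tau beta t) (phase_x lam nu M t) x y Hxy)
  as [z [Hz _]].
{ intros z _. apply is_derive_Reals. now apply phase_derive_x. }
assert (H := phase_slope lam nu M t z lam HM Hnu). apply Rabs_le_between in H. nra.
Qed.

Lemma has_heat_derivs_exp (E : R -> R -> R) (p : R -> R) (D sigma t x a b : R) :
  is_derive (fun s => E s x) t a -> (forall y, is_derive (E t) y (p y)) ->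
  is_derive p x b ->
  has_heat_derivs (fun s y => D * exp (sigma * E s y)) t x
    (D * exp (sigma * E t x) * (sigma * a))
    (D * exp (sigma * E t x) * (sigma * b + sigma ^ 2 * p x ^ 2)).
Proof.
intros Ha Hp Hb. split.
- auto_derive; [now exists a|]. rewrite (is_derive_unique (fun s : R => E s x) t a Ha). ring.
- exists (fun y => D * exp (sigma * E t y) * (sigma * p y)). split.
  + intros y. auto_derive; [now exists (p y)|].
    rewrite (is_derive_unique (fun y : R => E t y) y (p y) (Hp y)). ring.
  + auto_derive.
    * split; [now exists (p x)|]. split; [now exists b|easy].
    * rewrite (is_derive_unique (fun y : R => E t y) x (p x) (Hp x)).
      rewrite (is_derive_unique (fun y : R => p y) x b Hb). ring.
Qed.

Lemma phase_exp_cont (lam nu c M A tau beta D sigma : R) :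
  0 < M -> 0 < tau ->
  cont_closed_halfplane
    (fun t x => D * exp (sigma * phase lam nu c M A tau beta t x)).
Proof.
intros HM Htau. apply cont_closed_halfplane_continuous. intros t x Ht.
apply (continuous_comp
  (fun q : R * R => phase lam nu c M A tau beta (fst q) (snd q))
  (fun z => D * exp (sigma * z))).
2: { apply (ex_derive_continuous (V := R_NormedModule)). auto_derive. easy. }
assert (Hlin : forall k l : R,
  continuous (fun q : R * R => k * snd q + l * fst q) (t, x)).
{ intros k l. apply (continuous_plus (V := R_NormedModule));
    apply (continuous_mult (K := R_AbsRing));
    [apply continuous_const|apply continuous_snd|apply continuous_const
    |apply continuous_fst]. }
unfold phase. apply (continuous_plus (V := R_NormedModule)).
- apply (continuous_plus (V := R_NormedModule)).
  + apply (continuous_ext (fun q : R * R =>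
      beta + (- lam * snd q + lam * c * fst q))); [intros q; simpl; ring|].
    apply (continuous_plus (V := R_NormedModule)); [apply continuous_const|apply Hlin].
  + apply (continuous_ext (fun q : R * R =>
      nu / 2 * ln (M ^ 2 + (1 * snd q + (- 2 * lam) * fst q) ^ 2))).
    { intros q. do 4 f_equal. simpl. ring. }
    apply (continuous_comp
      (fun q : R * R => 1 * snd q + (- 2 * lam) * fst q)
      (fun z => nu / 2 * ln (M ^ 2 + z ^ 2))); [apply Hlin|].
    apply (ex_derive_continuous (V := R_NormedModule)). auto_derive.
    assert (H := sum_sq_pos M (1 * x + - 2 * lam * t) HM). simpl in *. lra.
- apply (continuous_comp fst (fun s => A / (s + tau))); [apply continuous_fst|].
  apply (ex_derive_continuous (V := R_NormedModule)). auto_derive. simpl. lra.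
Qed.

Lemma phase_equation (lam nu r M A tau beta D sigma kap t x : R) :
  0 < lam -> 0 < M -> 0 < t + tau -> 0 < kap ->
  kap * (t + tau) <= x - 2 * lam * t ->
  exists a b e,
    has_heat_derivs
      (fun s y => D * exp (sigma * phase lam nu (lam + r / lam) M A tau beta s y))
      t x a b /\
    a - b = D * exp (sigma * phase lam nu (lam + r / lam) M A tau beta t x) *
            (sigma * (r + e) - sigma * (sigma - 1) * phase_x lam nu M t x ^ 2) /\
    Rabs (e + A / (t + tau) ^ 2) <=
      (Rabs nu + nu ^ 2) / kap ^ 2 / (t + tau) ^ 2.
Proof.
intros Hlam HM Ht Hk Hy.
eexists; eexists.
set (y := x - 2 * lam * t) in *. assert (Hrho := sum_sq_pos M y HM).
exists (- (A / (t + tau) ^ 2) -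
        (nu * (M ^ 2 - y ^ 2) + nu ^ 2 * y ^ 2) / (M ^ 2 + y ^ 2) ^ 2).
split; [|split].
- apply has_heat_derivs_exp;
    [now apply phase_derive_t|intros z; now apply phase_derive_x|now apply phase_x_derive].
- unfold phase_x. fold y. field. repeat split; lra.
- set (th := t + tau) in *.
  replace (_ - _ + _)
    with (- ((nu * (M ^ 2 - y ^ 2) + nu ^ 2 * y ^ 2) / (M ^ 2 + y ^ 2) ^ 2)) by ring.
  rewrite Rabs_Ropp.
  assert (Hky : kap ^ 2 * th ^ 2 <= M ^ 2 + y ^ 2).
  { assert (0 <= kap * th) by nra. assert ((kap * th) ^ 2 <= y ^ 2) by nra. nra. }
  assert (Hkt : 0 < kap ^ 2 * th ^ 2) by (apply Rmult_lt_0_compat; nra).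
  set (rho := M ^ 2 + y ^ 2) in *.
  assert (Hn : 0 <= Rabs nu + nu ^ 2).
  { assert (H1 := Rabs_pos nu). assert (H2 := pow2_ge_0 nu). lra. }
  apply Rle_trans with ((Rabs nu + nu ^ 2) / rho).
  + unfold Rdiv at 1. rewrite Rabs_mult.
    rewrite (Rabs_pos_eq (/ rho ^ 2))
      by (left; apply Rinv_0_lt_compat; now apply pow_lt).
    apply Rle_div_l; [now apply pow_lt|].
    replace ((Rabs nu + nu ^ 2) / rho * rho ^ 2) with ((Rabs nu + nu ^ 2) * rho)
      by (field; lra).
    apply Rle_trans with (Rabs (nu * (M ^ 2 - y ^ 2)) + Rabs (nu ^ 2 * y ^ 2));
      [apply Rabs_triang|].
    rewrite Rabs_mult, (Rabs_pos_eq (nu ^ 2 * y ^ 2))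
      by (apply Rmult_le_pos; apply pow2_ge_0).
    assert (H0 := Rabs_pos nu). assert (H1 := pow2_ge_0 nu).
    assert (H2 := pow2_ge_0 y). assert (H3 := pow2_ge_0 M).
    assert (Hr : Rabs (M ^ 2 - y ^ 2) <= rho) by (apply Rabs_le; unfold rho; lra).
    assert (y ^ 2 <= rho) by (unfold rho; lra). nra.
  + replace ((Rabs nu + nu ^ 2) / kap ^ 2 / th ^ 2)
      with ((Rabs nu + nu ^ 2) / (kap ^ 2 * th ^ 2)) by (field; split; nra).
    apply Rmult_le_compat_l; [exact Hn|]. now apply Rinv_le_contravar.
Qed.

Lemma ln_le_linear (eps : R) :
  0 < eps -> exists k, 0 <= k /\ forall z, 0 < z -> ln z <= eps * z + k.
Proof.
intros He. exists (Rabs (ln eps)). split; [apply Rabs_pos|]. intros z Hz.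
assert (H := exp_ineq1_le (ln (eps * z))).
assert (Hez : 0 < eps * z) by now apply Rmult_lt_0_compat.
rewrite exp_ln in H by exact Hez. rewrite ln_mult in H by lra.
assert (H' := Rabs_maj2 (ln eps)). lra.
Qed.

Lemma Rabs_div_shift_le (A tau t : R) :
  0 <= t -> 0 < tau -> Rabs (A / (t + tau)) <= Rabs A / tau.
Proof.
intros Ht Htau. unfold Rdiv. rewrite Rabs_mult.
rewrite (Rabs_pos_eq (/ _)) by (left; apply Rinv_0_lt_compat; lra).
apply Rmult_le_compat_l; [apply Rabs_pos|]. apply Rinv_le_contravar; lra.
Qed.

(* At [x - 2 lam t = kap (t + tau)] the factor [exp (- lam (x - c t))] is about
   [exp (lam kap t)] because [c - 2 lam = 2 kap], which beats the power. *)
Lemma phase_rear (lam nu c M A tau : R) :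
  0 < lam -> 1 <= M -> 0 < tau -> Rabs nu <= 2 * lam * M -> 2 * lam < c ->
  exists k, forall beta t x, 0 <= t ->
    x - 2 * lam * t <= (c - 2 * lam) / 2 * (t + tau) ->
    beta - k <= phase lam nu c M A tau beta t x.
Proof.
intros Hlam HM Htau Hnu Hc. set (kap := (c - 2 * lam) / 2).
assert (Hk : 0 < kap) by (unfold kap; lra).
assert (Hn := Rabs_pos nu).
set (eps := lam / (Rabs nu + 1)).
assert (Heps : 0 < eps) by (apply Rdiv_lt_0_compat; lra).
assert (Hne : Rabs nu * eps <= lam).
{ assert ((Rabs nu + 1) * eps = lam) by (unfold eps; field; lra). nra. }
destruct (ln_le_linear eps Heps) as [k [Hk0 Hlnk]].
exists (2 * lam * kap * tau + lam * M + Rabs nu * k + Rabs A / tau).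
intros beta t x Ht Hx.
apply Rle_trans with
  (phase lam nu c M A tau beta t (2 * lam * t + kap * (t + tau)));
  [|apply phase_decreasing; lra].
unfold phase.
replace (2 * lam * t + kap * (t + tau) - 2 * lam * t) with (kap * (t + tau)) by ring.
set (z := kap * (t + tau)). assert (Hz : 0 < z) by (apply Rmult_lt_0_compat; lra).
assert (HA := Rabs_div_shift_le A tau t Ht Htau). apply Rabs_le_between in HA.
assert (Hz2 : 0 < z ^ 2) by now apply pow_lt.
assert (Hl0 : 0 <= ln (M ^ 2 + z ^ 2)).
{ rewrite <- ln_1. apply ln_le; [lra|]. nra. }
assert (Hl1 : ln (M ^ 2 + z ^ 2) <= 2 * (eps * (M + z) + k)).
{ apply Rle_trans with (ln ((M + z) * (M + z))); [apply ln_le; nra|].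
  rewrite ln_mult by lra. assert (H := Hlnk (M + z)). lra. }
assert (Hnl : - (Rabs nu * (eps * (M + z) + k)) <= nu / 2 * ln (M ^ 2 + z ^ 2)).
{ assert (- nu <= Rabs nu) by (rewrite <- Rabs_Ropp; apply Rle_abs). nra. }
assert (Rabs nu * (eps * (M + z)) <= lam * (M + z)) by nra.
assert (Hct : lam * (2 * lam * t + z - c * t) = - lam * z + 2 * lam * kap * tau).
{ unfold z, kap. field. }
rewrite Hct. lra.
Qed.

Lemma phase_initial (lam nu c M A tau : R) :
  0 < tau ->
  exists k, forall beta x, 1 <= x ->
    Rabs (phase lam nu c M A tau beta 0 x - (beta + nu * ln x - lam * x)) <= k.
Proof.
intros Htau. exists (Rabs nu / 2 * ln (M ^ 2 + 1) + Rabs A / tau).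
intros beta x Hx. unfold phase.
assert (HA := Rabs_div_shift_le A tau 0 (Rle_refl 0) Htau).
assert (HM := pow2_ge_0 M).
assert (Hx2 : 1 <= x ^ 2) by nra.
replace (x - 2 * lam * 0) with x by ring.
match goal with |- Rabs ?e <= _ => replace e
  with (nu / 2 * (ln (M ^ 2 + x ^ 2) - 2 * ln x) + A / (0 + tau)) end.
2: { field. lra. }
eapply Rle_trans; [apply Rabs_triang|]. apply Rplus_le_compat; [|exact HA].
rewrite Rabs_mult. replace (Rabs (nu / 2)) with (Rabs nu / 2)
  by (unfold Rdiv; rewrite Rabs_mult, (Rabs_pos_eq (/ 2)); lra).
assert (Hn := Rabs_pos nu). apply Rmult_le_compat_l; [lra|].
assert (Hl : 2 * ln x = ln (x ^ 2)).
{ replace (x ^ 2) with (x * x) by ring. rewrite ln_mult by lra. ring. }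
assert (H1 : ln (x ^ 2) <= ln (M ^ 2 + x ^ 2)) by (apply ln_le; lra).
assert (H2 : ln (M ^ 2 + x ^ 2) <= ln (M ^ 2 + 1) + ln (x ^ 2)).
{ rewrite <- ln_mult by lra. apply ln_le; nra. }
rewrite Rabs_pos_eq; lra.
Qed.

Lemma phase_front (lam nu c M A tau : R) :
  0 < lam -> 0 < tau -> 2 * lam < c ->
  exists k, forall beta C, exists T, 1 <= T /\ forall t, T <= t ->
    Rabs (phase lam nu c M A tau beta t (c * t + nu / lam * ln t + C)
          - (beta - lam * C)) <= k.
Proof.
intros Hlam Htau Hc. set (kap := (c - 2 * lam) / 2).
assert (Hk : 0 < kap) by (unfold kap; lra).
exists (Rabs nu / 2 * (Rabs (ln (kap ^ 2)) + Rabs (ln (M ^ 2 + 9 * kap ^ 2)))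
        + Rabs A / tau).
intros beta C.
set (q := Rabs (nu / lam)). assert (Hq : 0 <= q) by apply Rabs_pos.
set (eps := kap / (2 * (q + 1))).
assert (Heps : 0 < eps) by (apply Rdiv_lt_0_compat; lra).
assert (Hqe : q * eps <= kap / 2).
{ replace (kap / 2) with ((q + 1) * eps) by (unfold eps; field; lra). nra. }
destruct (ln_le_linear eps Heps) as [l [Hl0 Hl]].
set (h := q * l + Rabs C). assert (Hh : 0 <= h).
{ assert (H := Rabs_pos C). unfold h. nra. }
assert (H2k : 0 < 2 / kap) by (apply Rdiv_lt_0_compat; lra).
exists (1 + 2 / kap * h). split; [nra|]. intros t Ht.
assert (Ht1 : 1 <= t) by nra.
assert (Hht : h <= kap / 2 * t).
{ replace h with (kap / 2 * (2 / kap * h)) by (field; lra).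
  apply Rmult_le_compat_l; lra. }
assert (Hln : 0 <= ln t) by (rewrite <- ln_1; apply ln_le; lra).
assert (Hdev : Rabs (nu / lam * ln t + C) <= kap * t).
{ eapply Rle_trans; [apply Rabs_triang|]. rewrite Rabs_mult, (Rabs_pos_eq (ln t)) by lra.
  fold q. assert (H := Hl t). assert (q * ln t <= q * (eps * t + l)) by nra.
  unfold h in Hht. nra. }
apply Rabs_le_between in Hdev. unfold phase.
set (y := c * t + nu / lam * ln t + C - 2 * lam * t).
assert (Hy : kap * t <= y <= 3 * kap * t) by (unfold y, kap in *; lra).
assert (Ht2 : 1 <= t ^ 2) by nra.
assert (Hkt : 0 < kap * t) by (apply Rmult_lt_0_compat; lra).
assert (HM := pow2_ge_0 M). assert (Hkap2 : 0 < kap ^ 2) by now apply pow_lt.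
assert (Hy1 : kap ^ 2 * t ^ 2 <= M ^ 2 + y ^ 2) by nra.
assert (Hy2 : M ^ 2 + y ^ 2 <= (M ^ 2 + 9 * kap ^ 2) * t ^ 2) by nra.
assert (Hlt : 2 * ln t = ln (t ^ 2)).
{ replace (t ^ 2) with (t * t) by ring. rewrite ln_mult by lra. ring. }
assert (H1 : ln (kap ^ 2) + ln (t ^ 2) <= ln (M ^ 2 + y ^ 2)).
{ rewrite <- ln_mult by lra. apply ln_le; nra. }
assert (H2 : ln (M ^ 2 + y ^ 2) <= ln (M ^ 2 + 9 * kap ^ 2) + ln (t ^ 2)).
{ rewrite <- ln_mult by lra. apply ln_le; nra. }
match goal with |- Rabs ?e <= _ => replace e
  with (nu / 2 * (ln (M ^ 2 + y ^ 2) - 2 * ln t) + A / (t + tau)) end.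
2: { unfold y. field. lra. }
assert (HA : Rabs (A / (t + tau)) <= Rabs A / tau) by (apply Rabs_div_shift_le; lra).
eapply Rle_trans; [apply Rabs_triang|]. apply Rplus_le_compat; [|exact HA].
rewrite Rabs_mult. replace (Rabs (nu / 2)) with (Rabs nu / 2)
  by (unfold Rdiv; rewrite Rabs_mult, (Rabs_pos_eq (/ 2)); lra).
assert (Hn := Rabs_pos nu). apply Rmult_le_compat_l; [lra|].
assert (H3 := Rle_abs (ln (M ^ 2 + 9 * kap ^ 2))).
assert (H4 := Rabs_maj2 (ln (kap ^ 2))).
assert (H5 := Rabs_pos (ln (M ^ 2 + 9 * kap ^ 2))).
assert (H6 := Rabs_pos (ln (kap ^ 2))).
apply Rabs_le. lra.
Qed.

Lemma power_exp_tail (a nu lam x : R) :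
  0 < a -> a * Rpower x nu * exp (- lam * x) = exp (ln a + nu * ln x - lam * x).
Proof.
intros Ha. unfold Rpower. rewrite <- (exp_ln a) at 1 by exact Ha.
rewrite <- !exp_plus. f_equal. ring.
Qed.

(** * Barriers *)

Lemma upper_barrier (f u0 : R -> R) (u : R -> R -> R) (r lam nu a x1 : R) :
  classical_solution f u0 u -> (forall t x, 0 <= t -> 0 <= u t x <= 1) ->
  (forall s, 0 <= s <= 1 -> f s <= r * s) ->
  0 < lam -> lam ^ 2 < r -> 0 < a ->
  (forall x, x1 <= x -> u0 x <= a * Rpower x nu * exp (- lam * x)) ->
  exists M A tau beta, 0 < M /\ 0 < tau /\ Rabs nu <= 2 * lam * M /\
    forall t x, 0 <= t ->
      u t x <= exp (phase lam nu (lam + r / lam) M A tau beta t x).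
Proof.
intros Hu Hu01 Hf Hlam Hr Ha Htail.
set (c := lam + r / lam).
assert (Hrl : lam < r / lam) by (apply Rlt_div_r; nra).
assert (Hc : 2 * lam < c) by (unfold c; lra).
set (kap := (c - 2 * lam) / 2). assert (Hk : 0 < kap) by (unfold kap; lra).
assert (Hn := Rabs_pos nu).
set (M := 1 + Rabs nu / lam).
assert (Hnl : 0 <= Rabs nu / lam) by (apply Rdiv_le_0_compat; lra).
assert (HM : 1 <= M) by (unfold M; lra).
assert (HnM : Rabs nu <= 2 * lam * M).
{ assert (Rabs nu = lam * (Rabs nu / lam)) by (field; lra). unfold M. nra. }
set (A0 := (Rabs nu + nu ^ 2) / kap ^ 2).
set (tau := (Rabs x1 + 1) / kap).
assert (Hx1 := Rabs_pos x1).
assert (Htau : 0 < tau) by (apply Rdiv_lt_0_compat; lra).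
assert (Hkt : kap * tau = Rabs x1 + 1) by (unfold tau; field; lra).
destruct (phase_rear lam nu c M (- A0) tau) as [k2 Hrear]; try lra.
destruct (phase_initial lam nu c M (- A0) tau Htau) as [k3 Hinit].
set (beta := Rmax k2 (ln a + k3)).
assert (Hb2 : k2 <= beta) by apply Rmax_l.
assert (Hb3 : ln a + k3 <= beta) by apply Rmax_r.
exists M, (- A0), tau, beta.
split; [lra|]. split; [exact Htau|]. split; [exact HnM|].
set (E := phase lam nu c M (- A0) tau beta).
assert (Hbehind : forall t x, 0 <= t -> x - 2 * lam * t <= kap * (t + tau) ->
  1 <= exp (1 * E t x)).
{ intros t x Ht Hx. rewrite <- exp_0 at 1. apply exp_le_compat.
  specialize (Hrear beta t x Ht Hx). fold E in Hrear. lra. }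
intros t x Ht. rewrite <- (Rplus_0_l t) at 1.
replace (exp (E t x)) with (1 * exp (1 * E t x)) by (rewrite !Rmult_1_l; reflexivity).
apply (parabolic_comparison (fun t => u (0 + t)) (fun t x => 1 * exp (1 * E t x)) r t 1);
  [eapply solution_cont_shift; [exact Hu|lra]|apply phase_exp_cont; lra| | | |lra].
- intros s y Hs. rewrite Rplus_0_l. assert (H := Hu01 s y (proj1 Hs)).
  assert (H' := exp_pos (1 * E s y)). lra.
- intros y. rewrite Rplus_0_l, (proj1 Hu y), Rmult_1_l.
  destruct (Rle_lt_dec y (kap * tau)) as [Hy|Hy].
  + apply Rle_trans with 1; [rewrite <- (proj1 Hu y); apply Hu01; lra|].
    apply Hbehind; lra.
  + assert (H1 := Rle_abs x1).
    eapply Rle_trans; [apply Htail; lra|].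
    rewrite power_exp_tail by exact Ha. apply exp_le_compat.
    assert (H := Hinit beta y). assert (Hy1 : 1 <= y) by lra. specialize (H Hy1).
    fold E in H. apply Rabs_le_between in H. lra.
- intros s y Hs Hlt. rewrite Rplus_0_l in *. assert (Hus := Hu01 s y).
  assert (Hs0 : 0 <= s) by lra. specialize (Hus Hs0).
  assert (Hy : kap * (s + tau) <= y - 2 * lam * s).
  { apply Rnot_lt_le. intros Hy. assert (H := Hbehind s y Hs0). lra. }
  destruct (solution_heat_derivs f u0 u 0 s y Hu) as [a1 [b1 [Hd Hab]]]; [lra|].
  destruct (phase_equation lam nu r M (- A0) tau beta 1 1 kap s y)
    as [a2 [b2 [e [Hd2 [Hab2 He]]]]]; try lra.
  fold c in Hd2, Hab2. fold E in Hd2, Hab2.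
  exists a1, b1, a2, b2. split; [exact Hd|]. split; [exact Hd2|].
  rewrite Hab, Hab2, Rplus_0_l. fold A0 in He.
  assert (He0 : 0 <= e).
  { apply Rabs_le_between in He. unfold Rdiv in He. lra. }
  assert (Hfu := Hf _ Hus). assert (Hep := exp_pos (1 * E s y)). nra.
Qed.

Lemma lower_barrier (f u0 : R -> R) (u : R -> R -> R) (r K lam nu a x1 : R) :
  classical_solution f u0 u -> (forall t x, 0 <= t -> 0 <= u t x <= 1) ->
  (forall s, 0 <= s <= 1 -> r * s - K * s ^ 2 <= f s) ->
  0 < K -> 0 < lam -> lam ^ 2 < r -> 0 < a ->
  (forall x, x1 <= x -> a * Rpower x nu * exp (- lam * x) <= u0 x) ->
  exists M A tau beta D sigma,
    0 < M /\ 0 < tau /\ Rabs nu <= 2 * lam * M /\ 0 < D /\ 1 < sigma /\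
    forall t x, 0 <= t ->
      exp (phase lam nu (lam + r / lam) M A tau beta t x)
      - D * exp (sigma * phase lam nu (lam + r / lam) M A tau beta t x) <= u t x.
Proof.
intros Hu Hu01 Hf HK Hlam Hr Ha Htail.
set (c := lam + r / lam).
assert (Hrl : lam < r / lam) by (apply Rlt_div_r; nra).
assert (Hc : 2 * lam < c) by (unfold c; lra).
set (kap := (c - 2 * lam) / 2). assert (Hk : 0 < kap) by (unfold kap; lra).
assert (Hn := Rabs_pos nu).
assert (Hl2 : 0 < lam ^ 2) by now apply pow_lt.
assert (Hsig : exists sigma, 1 < sigma <= 2 /\ sigma * lam ^ 2 < r).
{ set (d := Rmin 1 ((r - lam ^ 2) / (2 * lam ^ 2))).
  assert (Hd : 0 < d) by (apply Rmin_pos; [lra|apply Rdiv_lt_0_compat; lra]).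
  assert (Hd1 : d <= 1) by apply Rmin_l.
  assert (Hd2 : d <= (r - lam ^ 2) / (2 * lam ^ 2)) by apply Rmin_r.
  exists (1 + d). split; [lra|].
  assert (d * lam ^ 2 <= (r - lam ^ 2) / (2 * lam ^ 2) * lam ^ 2)
    by (apply Rmult_le_compat_r; lra).
  replace ((r - lam ^ 2) / (2 * lam ^ 2) * lam ^ 2) with ((r - lam ^ 2) / 2) in H
    by (field; lra). lra. }
destruct Hsig as [sigma [Hs1 Hs2]].
set (gam := (sigma - 1) * (r - sigma * lam ^ 2)).
assert (Hgam : 0 < gam) by (apply Rmult_lt_0_compat; lra).
set (h := Rmin lam ((r - sigma * lam ^ 2) / (24 * lam))).
assert (Hh0 : 0 < h) by (apply Rmin_pos; [lra|apply Rdiv_lt_0_compat; lra]).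
assert (Hh1 : h <= lam) by apply Rmin_l.
assert (Hh2 : 3 * lam * h <= (r - sigma * lam ^ 2) / 8).
{ replace ((r - sigma * lam ^ 2) / 8)
    with (3 * lam * ((r - sigma * lam ^ 2) / (24 * lam))) by (field; lra).
  apply Rmult_le_compat_l; [lra|apply Rmin_r]. }
set (M := 1 + Rabs nu / h).
assert (Hnh : 0 <= Rabs nu / h) by (apply Rdiv_le_0_compat; lra).
assert (HM : 1 <= M) by (unfold M; lra).
assert (HnM : Rabs nu <= 2 * h * M).
{ assert (Rabs nu = h * (Rabs nu / h)) by (field; lra). unfold M. nra. }
assert (HnM' : Rabs nu <= 2 * lam * M) by nra.
set (A0 := (Rabs nu + nu ^ 2) / kap ^ 2).
assert (HA0 : 0 <= A0).
{ apply Rdiv_le_0_compat; [assert (H := pow2_ge_0 nu); lra|now apply pow_lt]. }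
assert (Hx1 := Rabs_pos x1).
set (tau := 1 + (Rabs x1 + 1) / kap + 16 * A0 / gam).
assert (Ht1 : 0 <= (Rabs x1 + 1) / kap) by (apply Rdiv_le_0_compat; lra).
assert (Ht2 : 0 <= 16 * A0 / gam) by (apply Rdiv_le_0_compat; lra).
assert (Htau : 1 <= tau) by (unfold tau; lra).
assert (Hkt : Rabs x1 + 1 <= kap * tau).
{ replace (Rabs x1 + 1) with (kap * ((Rabs x1 + 1) / kap)) by (field; lra).
  apply Rmult_le_compat_l; unfold tau; lra. }
assert (HAt : 16 * A0 <= gam * tau).
{ replace (16 * A0) with (gam * (16 * A0 / gam)) by (field; lra).
  apply Rmult_le_compat_l; unfold tau; lra. }
destruct (phase_rear lam nu c M A0 tau) as [k2 Hrear]; try lra.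
destruct (phase_initial lam nu c M A0 tau) as [k3 Hinit]; [lra|].
set (beta := ln a - k3).
set (D := 1 + 2 * K / gam + exp ((sigma - 1) * (k2 - beta))).
assert (Hd1 : 0 < 2 * K / gam) by (apply Rdiv_lt_0_compat; lra).
assert (Hd2 := exp_pos ((sigma - 1) * (k2 - beta))).
assert (HD1 : 1 <= D) by (unfold D; lra).
assert (HDK : 2 * K <= gam * D).
{ replace (2 * K) with (gam * (2 * K / gam)) by (field; lra).
  apply Rmult_le_compat_l; unfold D; lra. }
exists M, A0, tau, beta, D, sigma.
do 5 (split; [lra|]).
set (E := phase lam nu c M A0 tau beta).
assert (Hsplit : forall t x,
  exp (sigma * E t x) = exp (E t x) * exp ((sigma - 1) * E t x)).
{ intros t x. rewrite <- exp_plus. f_equal. ring. }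
assert (Hbehind : forall t x, 0 <= t -> x - 2 * lam * t <= kap * (t + tau) ->
  1 * exp (1 * E t x) - D * exp (sigma * E t x) <= 0).
{ intros t x Ht Hx. rewrite Hsplit, !Rmult_1_l.
  assert (Hp := exp_pos (E t x)).
  assert (H1 : 1 <= D * exp ((sigma - 1) * E t x)).
  { apply Rle_trans with
      (exp ((sigma - 1) * (k2 - beta)) * exp ((sigma - 1) * E t x)).
    - rewrite <- exp_plus. rewrite <- exp_0 at 1. apply exp_le_compat.
      specialize (Hrear beta t x Ht Hx). fold E in Hrear. nra.
    - apply Rmult_le_compat_r; [left; apply exp_pos|unfold D; lra]. }
  nra. }
assert (Hneg : forall t x,
  0 < 1 * exp (1 * E t x) - D * exp (sigma * E t x) -> E t x < 0).
{ intros t x. rewrite Hsplit, !Rmult_1_l. intros H. apply Rnot_le_lt. intros HE.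
  assert (H1 : 1 <= exp ((sigma - 1) * E t x)).
  { rewrite <- exp_0 at 1. apply exp_le_compat. nra. }
  assert (Hp := exp_pos (E t x)).
  assert (1 <= D * exp ((sigma - 1) * E t x)) by nra. nra. }
intros t x Ht. rewrite <- (Rplus_0_l t) at 3.
replace (exp (E t x)) with (1 * exp (1 * E t x)) by (rewrite !Rmult_1_l; reflexivity).
apply (parabolic_comparison
  (fun t x => 1 * exp (1 * E t x) - D * exp (sigma * E t x))
  (fun t => u (0 + t)) r t 1);
  [apply cont_closed_halfplane_minus; apply phase_exp_cont; lra
  |eapply solution_cont_shift; [exact Hu|lra]| | | |lra].
- intros s y Hs. rewrite Rplus_0_l. assert (H := Hu01 s y (proj1 Hs)).
  destruct (Rle_lt_dec (1 * exp (1 * E s y) - D * exp (sigma * E s y)) 0) as [Hv|Hv];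
    [lra|].
  assert (H' := exp_pos (sigma * E s y)). apply Hneg in Hv.
  assert (exp (1 * E s y) <= 1) by (rewrite <- exp_0 at 2; apply exp_le_compat; lra).
  assert (0 < D * exp (sigma * E s y)) by (apply Rmult_lt_0_compat; lra). lra.
- intros y. rewrite Rplus_0_l.
  destruct (Rle_lt_dec y (kap * tau)) as [Hy|Hy].
  + apply Rle_trans with 0; [apply Hbehind; lra|]. apply Hu01. lra.
  + rewrite (proj1 Hu y). assert (H1 := Rle_abs x1).
    eapply Rle_trans; [|apply Htail; lra].
    rewrite power_exp_tail by exact Ha.
    apply Rle_trans with (exp (E 0 y)).
    { rewrite !Rmult_1_l. assert (H' := exp_pos (sigma * E 0 y)). nra. }
    apply exp_le_compat.
    assert (H := Hinit beta y). assert (Hy1 : 1 <= y) by lra. specialize (H Hy1).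
    fold E in H. apply Rabs_le_between in H. unfold beta in H. lra.
- intros s y Hs Hlt. rewrite Rplus_0_l in *. assert (Hus := Hu01 s y).
  assert (Hs0 : 0 <= s) by lra. specialize (Hus Hs0).
  assert (Hv : 0 < 1 * exp (1 * E s y) - D * exp (sigma * E s y)) by lra.
  assert (Hy : kap * (s + tau) <= y - 2 * lam * s).
  { apply Rnot_lt_le. intros Hy. assert (H := Hbehind s y Hs0). lra. }
  destruct (solution_heat_derivs f u0 u 0 s y Hu) as [a1 [b1 [Hd Hab]]]; [lra|].
  destruct (phase_equation lam nu r M A0 tau beta 1 1 kap s y)
    as [a2 [b2 [e [Hde [Hab2 He]]]]]; try lra.
  destruct (phase_equation lam nu r M A0 tau beta D sigma kap s y)
    as [a3 [b3 [e' [Hde' [Hab3 He']]]]]; try lra.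
  fold c E in Hde, Hab2, Hde', Hab3.
  exists (a2 - a3), (b2 - b3), a1, b1.
  split; [now apply has_heat_derivs_minus|]. split; [exact Hd|].
  rewrite Hab, Rplus_0_l.
  replace (a2 - a3 - (b2 - b3)) with ((a2 - b2) - (a3 - b3)) by ring.
  rewrite Hab2, Hab3. fold A0 in He, He'.
  assert (Hth : 0 < s + tau) by lra.
  assert (HAe : A0 / (s + tau) ^ 2 <= gam / 16).
  { apply Rle_div_l; [now apply pow_lt|].
    assert (tau <= (s + tau) ^ 2) by nra. nra. }
  apply Rabs_le_between in He. apply Rabs_le_between in He'.
  assert (HAe0 : 0 <= A0 / (s + tau) ^ 2) by (apply Rdiv_le_0_compat; [lra|now apply pow_lt]).
  assert (He0 : e <= 0) by lra.
  assert (He0' : - (gam / 8) <= e') by lra.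
  assert (Hp2 : phase_x lam nu M s y ^ 2 <= lam ^ 2 + (r - sigma * lam ^ 2) / 8).
  { assert (H := phase_slope lam nu M s y h). assert (HM0 : 0 < M) by lra.
    specialize (H HM0 HnM). apply Rabs_le_between in H. nra. }
  assert (HE := Hneg s y Hv).
  set (w := exp (1 * E s y)) in *. set (ws := exp (sigma * E s y)) in *.
  assert (Hw : 0 < w) by apply exp_pos.
  assert (Hws : 0 < ws) by apply exp_pos.
  assert (Hww : w ^ 2 <= ws).
  { unfold w, ws. replace (exp (1 * E s y) ^ 2) with (exp (2 * E s y))
      by (simpl; rewrite Rmult_1_r, <- exp_plus; f_equal; ring).
    apply exp_le_compat. nra. }
  assert (Hfu := Hf _ Hus).
  set (P := phase_x lam nu M s y ^ 2) in *.
  assert (HP : r + gam / 2 <= sigma * (r + e') - sigma * (sigma - 1) * P).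
  { assert (sigma * e' >= - (gam / 4)) by nra.
    assert (HsP : sigma * (sigma - 1) * P <=
      sigma * (sigma - 1) * (lam ^ 2 + (r - sigma * lam ^ 2) / 8))
      by (apply Rmult_le_compat_l; nra).
    assert (Hg1 : sigma * (sigma - 1) * ((r - sigma * lam ^ 2) / 8) = sigma * gam / 8)
      by (unfold gam; field).
    assert (Hg2 : sigma * r - r - sigma * (sigma - 1) * lam ^ 2 = gam)
      by (unfold gam; ring).
    nra. }
  assert (HDws : 0 < D * ws) by (apply Rmult_lt_0_compat; lra).
  assert (H1 : D * ws * (r + gam / 2) <=
               D * ws * (sigma * (r + e') - sigma * (sigma - 1) * P))
    by (apply Rmult_le_compat_l; lra).
  assert (H2 : K * w ^ 2 <= D * ws * (gam / 2)).
  { assert (K * w ^ 2 <= K * ws) by (apply Rmult_le_compat_l; lra).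
    assert (K * ws <= (gam * D / 2) * ws) by (apply Rmult_le_compat_r; lra). lra. }
  assert (H3 : w * e <= 0) by nra.
  set (v := 1 * w - D * ws) in *.
  assert (Hvw : v <= w) by (unfold v; lra).
  assert (H4 : K * v ^ 2 <= K * w ^ 2) by (apply Rmult_le_compat_l; [lra|]; nra).
  assert (H5 : K * u s y ^ 2 <= K * v ^ 2) by (apply Rmult_le_compat_l; [lra|]; nra).
  unfold v in *. lra.
Qed.

Theorem theorem1p2
  (f g : R -> R)
  (* f is C^2 on [0,1]: it coincides there with a C^2 function g on R *)
  (Hg : C2_on_R g)
  (Hfg : forall s, 0 <= s <= 1 -> f s = g s)
  (* linear (affine) extension outside [0,1] *)
  (Hext0 : forall s, s < 0 -> f s = Derive g 0 * s)
  (Hext1 : forall s, 1 < s -> f s = Derive g 1 * (s - 1))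
  (Hf0 : f 0 = 0) (Hf1 : f 1 = 0)
  (Hkpp : forall s, 0 < s < 1 -> 0 < f s /\ f s <= Derive g 0 * s)
  (lambda : R) (Hlam : 0 < lambda < sqrt (Derive g 0))
  (u0 : R -> R)
  (Hu0c : forall x, continuous u0 x)
  (Hu0r : forall x, 0 <= u0 x <= 1)
  (Hu0nz : exists x, u0 x <> 0)
  (nu a1 a2 : R) (Ha : 0 < a1 <= a2)
  (Htail : exists x1, forall x, x1 <= x ->
      a1 * Rpower x nu * exp (- lambda * x) <= u0 x /\
      u0 x <= a2 * Rpower x nu * exp (- lambda * x))
  (u : R -> R -> R) (Hu : classical_solution f u0 u) :
  let c := lambda + Derive g 0 / lambda in
  forall m, 0 < m < 1 ->
    exists T C, forall t, T <= t ->
      (exists x, m <= u t x) /\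
      bound (fun x => m <= u t x) /\
      (forall X, is_lub (fun x => m <= u t x) X ->
         Rabs (X - c * t - (nu / lambda) * ln t) <= C).
Proof.
intros c m Hm. set (r := Derive g 0) in *.
assert (Hr : lambda ^ 2 < r).
{ destruct (Rle_lt_dec r 0) as [H|H].
  - rewrite sqrt_neg_0 in Hlam by exact H. lra.
  - rewrite <- (sqrt_sqrt r) by lra. nra. }
assert (Hl0 : 0 < lambda) by lra. assert (Hl2 : 0 < lambda ^ 2) by now apply pow_lt.
assert (Hg0 : g 0 = 0) by (rewrite <- Hfg by lra; exact Hf0).
assert (Hu01 : forall t x, 0 <= t -> 0 <= u t x <= 1).
{ intros t x Ht. split.
  - apply (solution_ge_0 f u0 u r Hu Hext0); [apply Hu0r|exact Ht].
  - apply (solution_le_1 f u0 u (Derive g 1) Hu Hext1); [apply Hu0r|exact Ht]. }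
assert (Hfle : forall s, 0 <= s <= 1 -> f s <= r * s).
{ intros s Hs. destruct (Req_dec s 0) as [->|H0]; [rewrite Hf0; lra|].
  destruct (Req_dec s 1) as [->|H1]; [rewrite Hf1; lra|]. apply Hkpp; lra. }
destruct (C2_ge_quadratic g Hg Hg0) as [K [HK Hquad]]. fold r in Hquad.
assert (Hfge : forall s, 0 <= s <= 1 -> r * s - K * s ^ 2 <= f s).
{ intros s Hs. rewrite Hfg by exact Hs. now apply Hquad. }
destruct (kpp_ge_linear f g r K m) as [theta [Hth Hlin]]; try easy; try lra.
{ intros x. apply (ex_derive_continuous (V := R_NormedModule)). apply Hg. }
{ intros s Hs. now apply Hkpp. }
destruct Htail as [x1 Htail].
destruct (upper_barrier f u0 u r lambda nu a2 x1)
  as [M [A [tau [beta [HM [Htau [HnM Hup]]]]]]]; try easy; try lra.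
{ intros x Hx. now apply Htail. }
destruct (lower_barrier f u0 u r K lambda nu a1 x1)
  as [M' [A' [tau' [beta' [D [sigma [HM' [Htau' [HnM' [HD [Hsig Hlow]]]]]]]]]]];
  try easy; try lra.
{ intros x Hx. now apply Htail. }
fold c in Hup, Hlow.
assert (Hc : 2 * lambda < c).
{ assert (lambda < r / lambda) by (apply Rlt_div_r; nra). unfold c. lra. }
destruct (phase_front lambda nu c M A tau Hl0 Htau Hc) as [k Hfront].
destruct (phase_front lambda nu c M' A' tau' Hl0 Htau' Hc) as [k' Hfront'].
set (front := fun t => c * t + nu / lambda * ln t).
set (Cu := (beta + k - ln m) / lambda + 1).
destruct (Hfront beta Cu) as [Tu [HTu Hfu]].
assert (Hahead : forall t x, Tu <= t -> front t + Cu <= x -> u t x < m).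
{ intros t x Ht Hx. eapply Rle_lt_trans; [apply Hup; lra|].
  rewrite <- (exp_ln m) at 1 by lra. apply exp_increasing.
  eapply Rle_lt_trans; [apply phase_decreasing; [exact HM|exact HnM|exact Hx]|].
  specialize (Hfu t Ht). fold (front t) in Hfu. apply Rabs_le_between in Hfu.
  assert (lambda * Cu = beta + k - ln m + lambda) by (unfold Cu; field; lra). lra. }
set (C1 := (beta' + k' + ln (2 * D) / (sigma - 1)) / lambda).
destruct (bump_growth f u0 u theta m Hu) as [L [HL Hbump]]; try easy; try lra.
{ intros t x Ht. now apply Hu01. }
destruct (Hfront' beta' C1) as [T1 [HT1 Hf1']].
destruct (Hfront' beta' (C1 + 2 * L)) as [T2 [HT2 Hf2']].
set (delta := exp (beta' - lambda * (C1 + 2 * L) - k') / 2).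
assert (Hdelta : 0 < delta).
{ unfold delta. assert (H := exp_pos (beta' - lambda * (C1 + 2 * L) - k')). lra. }
assert (Hplateau : forall t x, T1 <= t -> T2 <= t ->
  front t + C1 <= x <= front t + (C1 + 2 * L) -> delta <= u t x).
{ intros t x H1 H2 Hx. eapply Rle_trans; [|apply Hlow; lra].
  set (E := phase lambda nu c M' A' tau' beta' t x).
  specialize (Hf1' t H1). specialize (Hf2' t H2).
  fold (front t) in Hf1', Hf2'.
  apply Rabs_le_between in Hf1'. apply Rabs_le_between in Hf2'.
  assert (HE1 : E <= phase lambda nu c M' A' tau' beta' t (front t + C1))
    by (apply phase_decreasing; lra).
  assert (HE2 : phase lambda nu c M' A' tau' beta' t (front t + (C1 + 2 * L)) <= E)
    by (apply phase_decreasing; lra).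
  replace (exp (sigma * E)) with (exp E * exp ((sigma - 1) * E))
    by (rewrite <- exp_plus; f_equal; ring).
  assert (Hhalf : D * exp ((sigma - 1) * E) <= / 2).
  { apply Rle_trans with (D * exp (- ln (2 * D))).
    - apply Rmult_le_compat_l; [lra|]. apply exp_le_compat.
      assert ((sigma - 1) * (beta' - lambda * C1 + k') = - ln (2 * D))
        by (unfold C1; field; lra).
      nra.
    - rewrite exp_Ropp, exp_ln by lra. right. field. lra. }
  assert (HeE : exp (beta' - lambda * (C1 + 2 * L) - k') <= exp E)
    by (apply exp_le_compat; lra).
  assert (Hp := exp_pos E). unfold delta. nra. }
destruct (Hbump delta Hdelta) as [s0 [Hs0 Hlift]].
exists (Tu + T1 + T2 + 2 * s0),
  (Rabs Cu + c * s0 + Rabs (nu / lambda) * ln 2 + Rabs (C1 + L)).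
intros t Ht.
set (xc := front (t - s0) + (C1 + L)).
assert (Hxc : m <= u t xc).
{ replace t with (t - s0 + s0) at 1 by ring. apply Hlift; [lra|].
  intros x Hx. apply Rabs_le_between in Hx. unfold xc in Hx. apply Hplateau; lra. }
assert (Hub : forall x, m <= u t x -> x <= front t + Cu).
{ intros x Hx. apply Rnot_lt_le. intros H.
  assert (H' := Hahead t x). lra. }
split; [now exists xc|]. split; [now exists (front t + Cu)|].
intros X [HX1 HX2]. specialize (HX1 xc Hxc). specialize (HX2 _ Hub).
unfold xc, front in HX1. unfold front in HX2.
assert (Hln : Rabs (ln t - ln (t - s0)) <= ln 2).
{ assert (ln (t - s0) <= ln t) by (apply ln_le; lra).
  assert (ln t <= ln (2 * (t - s0))) by (apply ln_le; lra).
  rewrite ln_mult in H0 by lra. apply Rabs_le. lra. }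
assert (Hnln : Rabs (nu / lambda * (ln t - ln (t - s0))) <= Rabs (nu / lambda) * ln 2).
{ rewrite Rabs_mult. apply Rmult_le_compat_l; [apply Rabs_pos|exact Hln]. }
apply Rabs_le_between in Hnln.
assert (H1 := Rle_abs Cu). assert (H2 := Rabs_maj2 (C1 + L)).
assert (H3 := Rabs_pos Cu). assert (H4 := Rabs_pos (C1 + L)).
assert (H5 : 0 <= c * s0) by (apply Rmult_le_pos; lra).
assert (H6 : 0 <= Rabs (nu / lambda) * ln 2).
{ apply Rmult_le_pos; [apply Rabs_pos|]. rewrite <- ln_1. apply ln_le; lra. }
apply Rabs_le. lra.
Qed.
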